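(* Let $\mathbb{K}$ be an algebraically closed field of characteristic zero and let $X$ be an irreducible affine algebraic variety over $\mathbb{K}$. Suppose that $\mathrm{LND}^*(X)\neq\emptyset$, i.e. there exists a locally nilpotent derivation of $\mathbb{K}[X]$ which has a slice. Then $\mathrm{ML}(X)=\mathrm{ML}^*(X)$ as subalgebras of $\mathbb{K}[X]$.
   Context: $\mathbb{K}[X]$ denotes the algebra of regular functions on $X$. A derivation of $\mathbb{K}[X]$ is a $\mathbb{K}$-linear map $\partial:\mathbb{K}[X]\to\mathbb{K}[X]$ with $\partial(fg)=f\partial(g)+g\partial(f)$. It is locally nilpotent (an LND) if for each $f\in\mathbb{K}[X]$ there is an integer $m>0$ with $\partial^m(f)=0$. $\mathrm{LND}(X)$ is the set of all locally nilpotent derivations of $\mathbb{K}[X]$. A slice of $\partial\in\mathrm{LND}(X)$ is an element $s\in\mathbb{K}[X]$ with $\partial(s)=1$; $\mathrm{LND}^*(X)\subseteq\mathrm{LND}(X)$ is the set of all locally nilpotent derivations having a slice. The Makar-Limanov invariant is $\mathrm{ML}(X)=\bigcap_{\partial\in\mathrm{LND}(X)}\mathrm{Ker}\,\partial$. When $\mathrm{LND}^*(X)\neq\emptyset$, the modified Makar-Limanov invariant is $\mathrm{ML}^*(X)=\bigcap_{\partial\in\mathrm{LND}^*(X)}\mathrm{Ker}\,\partial$. *)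

(* Defs.v *)
From HB Require Import structures.
From mathcomp Require Import all_boot all_order all_algebra.
From mathcomp Require Import boolp classical_sets functions.
From mathcomp Require Import mpoly.

Set Implicit Arguments.
Unset Strict Implicit.
Unset Printing Implicit Defensive.

Import GRing.Theory.
Local Open Scope classical_set_scope.
Local Open Scope ring_scope.

Definition zero_locus (K : closedFieldType) (n : nat) (S : set {mpoly K[n]}) :
  set ('I_n -> K) := [set x | forall p, S p -> p.@[x] = 0].

Definition algebraic_set (K : closedFieldType) (n : nat)
  (X : set ('I_n -> K)) : Prop := exists S, X = zero_locus S.

(* Irreducibility in the Zariski topology. The closed subsets of an algebraic
   set X are the algebraic subsets of affine n-space contained in X. *)
Definition irreducible_set (K : closedFieldType) (n : nat)
    (X : set ('I_n -> K)) : Prop :=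
  X !=set0 /\
  forall Y Z : set ('I_n -> K), algebraic_set Y -> algebraic_set Z ->
    X = Y `|` Z -> Y = X \/ Z = X.

Record irr_affine_variety (K : closedFieldType) (n : nat) := IrrAffineVariety {
  points :> set ('I_n -> K);
  points_algebraic : algebraic_set points;
  points_irreducible : irreducible_set points
}.

Section CoordinateRing.
Variables (K : closedFieldType) (n : nat) (X : irr_affine_variety K n).

(* The ambient type of all functions X -> K carries the pointwise operations;
   K[X] is its subalgebra of restrictions of polynomials. The codomain is
   written K^o so that the functions form a K-module. *)
Definition regular_pred : {pred (points X -> K^o)} :=
  fun f => `[< exists p : {mpoly K[n]}, f = fun x => p.@[val x] >].

Lemma regular_subring_closed : subring_closed regular_pred.
Proof.
split.
- by apply/asboolP; exists 1; apply/funext => x; rewrite meval1.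
- move=> f g /asboolP [p ->] /asboolP [q ->]; apply/asboolP; exists (p - q).
  by apply/funext => x; rewrite mevalB.
- move=> f g /asboolP [p ->] /asboolP [q ->]; apply/asboolP; exists (p * q).
  by apply/funext => x; rewrite mevalM.
Qed.

Lemma regular_scaler_closed : scaler_closed regular_pred.
Proof.
move=> a f /asboolP [p ->]; apply/asboolP; exists (a *: p).
by apply/funext => x; rewrite mevalZ.
Qed.

HB.instance Definition _ :=
  GRing.isSubringClosed.Build _ regular_pred regular_subring_closed.
HB.instance Definition _ :=
  GRing.isScaleClosed.Build K _ regular_pred regular_scaler_closed.

Record coord_ring := CoordRing {
  coord_fun :> points X -> K^o;
  coord_funP : coord_fun \in regular_pred
}.

HB.instance Definition _ := [isSub for coord_fun].
HB.instance Definition _ := [Choice of coord_ring by <:].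
HB.instance Definition _ :=
  GRing.SubChoice_isSubComPzRing.Build _ regular_pred coord_ring
    (subringClosedP regular_pred).
HB.instance Definition _ := [SubZmodule_isSubLmodule of coord_ring by <:].

Lemma coord_ring_oner_neq0 : 1 != 0 :> coord_ring.
Proof.
have [[x Xx] _] := points_irreducible X.
apply/eqP => /(congr1 (fun f : coord_ring => f (SigSub (mem_set Xx)))).
exact/eqP/oner_neq0.
Qed.

HB.instance Definition _ :=
  GRing.PzSemiRing_isNonZero.Build coord_ring coord_ring_oner_neq0.

Lemma coord_ring_scalerAl (a : K) (f g : coord_ring) :
  a *: (f * g) = (a *: f) * g.
Proof. by apply/val_inj/funext => x; exact: mulrA. Qed.

HB.instance Definition _ :=
  GRing.LSemiModule_isLSemiAlgebra.Build K coord_ring coord_ring_scalerAl.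

Lemma coord_ring_scalerAr (a : K) (f g : coord_ring) :
  a *: (f * g) = f * (a *: g).
Proof. by apply/val_inj/funext => x; exact: mulrCA. Qed.

HB.instance Definition _ :=
  GRing.LSemiAlgebra_isSemiAlgebra.Build K coord_ring coord_ring_scalerAr.

End CoordinateRing.

Section MakarLimanov.
Variables (K : fieldType) (A : comAlgType K).

Definition is_derivation (D : {linear A -> A}) : Prop :=
  forall f g, D (f * g) = f * D g + g * D f.

Definition locally_nilpotent (D : {linear A -> A}) : Prop :=
  forall f, exists2 m, (0 < m)%N & iter m D f = 0.

Definition LND : set {linear A -> A} :=
  [set D | is_derivation D /\ locally_nilpotent D].

Definition is_slice (D : {linear A -> A}) (s : A) : Prop := D s = 1.

Definition LND_star : set {linear A -> A} :=
  [set D | LND D /\ exists s, is_slice D s].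

Definition Ker (D : {linear A -> A}) : set A := [set f | D f = 0].

Definition ML : set A := \bigcap_(D in LND) Ker D.

(* Only meaningful when LND_star is nonempty. *)
Definition ML_star : set A := \bigcap_(D in LND_star) Ker D.

End MakarLimanov.

Arguments LND {K} A.
Arguments LND_star {K} A.
Arguments ML {K} A.
Arguments ML_star {K} A.

(* Main.v *)
Require Import Defs.
From HB Require Import structures.
From mathcomp Require Import all_boot all_order all_algebra.
From mathcomp Require Import boolp classical_sets functions.
From mathcomp Require Import mpoly.
Local Open Scope classical_set_scope.
Local Open Scope ring_scope.

Set Implicit Arguments.
Unset Strict Implicit.
Unset Printing Implicit Defensive.

Import GRing.Theory.

(** The theorem holds for every commutative algebra [A] over a field of
    characteristic zero that is an integral domain ([ML_eq_ML_star]); the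
    coordinate ring of an irreducible variety is one ([coord_ring_domain]).

    Write M for [ML_star A].  Only M inside [ML A] needs a proof.  Let [D] be a
    locally nilpotent derivation, [f] in M, and suppose [D f != 0].

    - M is stable under [D] ([ML_star_stable]): conjugating a derivation with a
      slice by the automorphism exp(tD) gives a derivation with a slice, so
      every derivation [E] with a slice kills exp(tD) f for all scalars t; this
      is a polynomial in t with infinitely many roots, and its linear
      coefficient is [E (D f)].  Replacing [f] by its last iterate under [D]
      that [D] does not kill, one may assume [D (D f) = 0].
    - If [D u = 0], then u D is again a locally nilpotent derivation, so
      [u * D f] lies in M.  Kernels of locally nilpotent derivations of a domain
      are factorially closed ([kernel_factorially_closed]), hence so is M, and
      [u] lies in M ([ML_star_kernel]).
    - Thus M contains the kernel of [D] and the local slice [f].  Every element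
      of [A] has a nonzero multiple in the subalgebra they generate, so M is all
      of [A] ([ML_star_full]).

    This is absurd, since a slice is not in the kernel of its derivation.

    The exponential of [D] is handled through [exp_poly], the polynomial
    exp(XD) f in [A[X]].  It is the unique solution of p' = D p with p(0) = f,
    which makes exp(XD) multiplicative without binomial computations; its
    degree is the degree function attached to [D]. *)

(** * Consequences of characteristic zero *)

(** Over a ring with zero divisors a polynomial may have more roots than its
    degree; the bound survives for roots that are scalars, because their
    differences are invertible. *)
Lemma eq0_of_scalar_roots (K : fieldType) (A : comAlgType K) (rs : seq K)
    (p : {poly A}) :
  uniq rs -> (forall r, r \in rs -> p.[r%:A] = 0) -> (size p <= size rs)%N ->
  p = 0.
Proof.
elim: rs p => [|r rs IH] p /=; first by move=> _ _ /size_poly_leq0P.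
case/andP=> r_rs uniq_rs p0 szp.
have /factor_theorem[q pE] : root p r%:A by apply/rootP/p0; rewrite mem_head.
have [q0|q_neq0] := eqVneq q 0; first by rewrite pE q0 mul0r.
rewrite pE size_Mmonic ?monicXsubC // size_XsubC addn2 /= in szp.
rewrite pE (IH q) ?mul0r // => b b_rs.
have := p0 b; rewrite inE b_rs orbT => /(_ isT).
rewrite pE hornerM_comm; last exact: mulrC.
rewrite hornerXsubC -scalerBl mulrC mulr_algl.
move/(congr1 (fun x => (b - r)^-1 *: x)).
rewrite scaler0 scalerA mulVf ?scale1r // subr_eq0.
by apply: contraNneq r_rs => <-.
Qed.

Section Exponential.
Variables (K : fieldType) (A : comAlgType K).
Hypothesis char0 : [pchar K] =i pred0.

Let natK_neq0 m : (m.+1)%:R != 0 :> K.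
Proof. by rewrite ((pcharf0P K).1 char0). Qed.

Let factK_neq0 m : (m`!)%:R != 0 :> K.
Proof. by rewrite ((pcharf0P K).1 char0) // -lt0n fact_gt0. Qed.

Lemma mulrSn_eq0 m (a : A) : a *+ m.+1 = 0 -> a = 0.
Proof.
rewrite -scaler_nat => /(congr1 (fun x => m.+1%:R^-1 *: x)).
by rewrite scalerA mulVf // scale1r scaler0.
Qed.

Lemma natK_inj : injective (fun i : nat => i%:R : K).
Proof.
move=> i j; wlog le_ij : i j / (i <= j)%N => [hw|/eqP].
  by case/orP: (leq_total i j) => /hw // h /esym /h.
rewrite -(subnK le_ij) natrD -subr_eq0 opprD addrCA subrr addr0 oppr_eq0.
by rewrite ((pcharf0P K).1 char0) => /eqP ->.
Qed.

(** * The exponential of a locally nilpotent derivation *)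

Lemma derivation1 (D : {linear A -> A}) : is_derivation D -> D 1 = 0.
Proof.
move=> dD; have /eqP := dD 1 1; rewrite !mul1r -subr_eq0 opprD addNKr oppr_eq0.
by move/eqP.
Qed.

Lemma map_poly_derivation (D : {linear A -> A}) (p q : {poly A}) :
  is_derivation D ->
  map_poly D (p * q) = p * map_poly D q + map_poly D p * q.
Proof.
move=> dD; apply/polyP => n.
rewrite coef_map coefD !coefM raddf_sum -big_split /=.
by apply: eq_bigr => i _; rewrite dD !coef_map [X in _ + X]mulrC.
Qed.

(** Uniqueness for the differential equation p' = D p: the coefficient of
    degree n determines n + 1 times the next one, and n + 1 is invertible. *)
Lemma eq_exp_solution (D : {linear A -> A}) (p q : {poly A}) :
  p^`() = map_poly D p -> q^`() = map_poly D q -> p`_0 = q`_0 -> p = q.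
Proof.
move=> Dp Dq eq0; apply/polyP; elim=> [//|n IHn].
apply/eqP; rewrite -subr_eq0; apply/eqP/(@mulrSn_eq0 n).
by rewrite mulrnBl -!coef_deriv Dp Dq !coef_map IHn subrr.
Qed.

Lemma iter_is_linear (D : {linear A -> A}) n : linear (iter n D).
Proof. by move=> a f g; elim: n => //= n ->; rewrite linearP. Qed.

HB.instance Definition _ (D : {linear A -> A}) n :=
  GRing.isLinear.Build K A A *:%R (iter n D) (iter_is_linear D n).

Lemma iter_kernel (D : {linear A -> A}) n m f :
  (n <= m)%N -> iter n D f = 0 -> iter m D f = 0.
Proof. by move=> /subnK <- Df; rewrite iterD Df linear0. Qed.

Lemma horner_map_scalar (D : {linear A -> A}) (p : {poly A}) (t : K) :
  (map_poly D p).[t%:A] = D p.[t%:A].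
Proof.
rewrite /map_poly horner_poly horner_coef linear_sum; apply: eq_bigr => i _ /=.
by rewrite exprZn expr1n !mulr_algr linearZ.
Qed.

Section OneDerivation.
Variables (D : {linear A -> A}) (nilD : locally_nilpotent D).

Definition divided_power i f : A := i`!%:R^-1 *: iter i D f.

(** The polynomial exp(XD) f, truncated at some order that annihilates [f]; the
    coefficients do not depend on this order, see [coef_exp_poly]. *)
Definition exp_poly f : {poly A} :=
  \poly_(i < sval (cid2 (nilD f))) divided_power i f.

Lemma coef_exp_poly f i : (exp_poly f)`_i = divided_power i f.
Proof.
rewrite coef_poly; case: cid2 => m /= _ Df; case: ltnP => // le_mi.
by rewrite /divided_power (iter_kernel le_mi Df) scaler0.
Qed.

Lemma exp_poly_coef0 f : (exp_poly f)`_0 = f.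
Proof. by rewrite coef_exp_poly /divided_power invr1 scale1r. Qed.

Lemma deriv_exp_poly f : (exp_poly f)^`() = map_poly D (exp_poly f).
Proof.
apply/polyP => i; rewrite coef_deriv coef_map !coef_exp_poly /divided_power.
rewrite /= linearZ /= -scaler_nat scalerA factS natrM invfM mulrA mulfV //.
by rewrite mul1r.
Qed.

Lemma exp_poly_linear a f g :
  exp_poly (a *: f + g) = a%:A *: exp_poly f + exp_poly g.
Proof.
apply/polyP => i; rewrite coefD coefZ !coef_exp_poly.
rewrite /divided_power linearP.
by rewrite scalerDr mulr_algl !scalerA mulrC.
Qed.

(** Coefficientwise this is the composition rule of divided powers; in this form
    Taylor's formula turns it into exp(sD) exp(tD) = exp((s + t)D). *)
Lemma exp_poly_divided_power f i :
  exp_poly (divided_power i f) = (exp_poly f)^`N(i).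
Proof.
apply/polyP => j; rewrite coef_nderivn !coef_exp_poly /divided_power.
rewrite linearZ /= -iterD addnC.
rewrite scalerA -scaler_nat scalerA; congr (_ *: _).
rewrite -(bin_fact (leq_addr j i)) addKn !natrM !invfM mulVKf 1?mulrC //.
by rewrite ((pcharf0P K).1 char0) // -lt0n bin_gt0 leq_addr.
Qed.

Definition exp_at (t : K) f : A := (exp_poly f).[t%:A].

Lemma exp_at_linear t : linear (exp_at t).
Proof.
by move=> a f g; rewrite /exp_at exp_poly_linear hornerD hornerZ mulr_algl.
Qed.

HB.instance Definition _ t :=
  GRing.isLinear.Build K A A *:%R (exp_at t) (exp_at_linear t).

Lemma exp_atD s t f : exp_at s (exp_at t f) = exp_at (s + t) f.
Proof.
rewrite [exp_at t f]horner_coef linear_sum /= [RHS]/exp_at scalerDl.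
rewrite nderiv_taylor; last exact: mulrC.
apply: eq_bigr => i _; rewrite -exp_poly_divided_power coef_exp_poly.
by rewrite exprZn expr1n [in LHS]mulr_algr [in RHS]mulr_algr linearZ.
Qed.

Lemma exp_at0 f : exp_at 0 f = f.
Proof. by rewrite /exp_at scale0r horner_coef0 exp_poly_coef0. Qed.

Lemma exp_atK t : cancel (exp_at t) (exp_at (- t)).
Proof. by move=> f; rewrite exp_atD addNr exp_at0. Qed.

Lemma exp_atNK t : cancel (exp_at (- t)) (exp_at t).
Proof. by move=> f; rewrite exp_atD subrr exp_at0. Qed.

Lemma exp_poly_const f : D f = 0 -> exp_poly f = f%:P.
Proof.
move=> Df; apply/polyP => -[|i]; rewrite coefC ?exp_poly_coef0 //=.
rewrite coef_exp_poly /divided_power (@iter_kernel D 1) ?scaler0 //.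
Qed.

Hypothesis derD : is_derivation D.

Lemma exp_polyM f g : exp_poly (f * g) = exp_poly f * exp_poly g.
Proof.
apply: (@eq_exp_solution D); first exact: deriv_exp_poly.
  by rewrite derivM map_poly_derivation // !deriv_exp_poly addrC.
by rewrite coef0M !exp_poly_coef0.
Qed.

Lemma exp_atM t f g : exp_at t (f * g) = exp_at t f * exp_at t g.
Proof. by rewrite /exp_at exp_polyM hornerM. Qed.

Lemma exp_at1 t : exp_at t 1 = 1.
Proof.
by rewrite /exp_at exp_poly_const ?hornerC //; exact: derivation1.
Qed.

(** Since [exp_poly] is multiplicative and [A] is a domain, degrees in X add up,
    so the factors of an element with constant exponential have constant
    exponential; and [D f] is the linear coefficient of [exp_poly f]. *)
Lemma kernel_factorially_closed f g :
  GRing.integral_domain_axiom A -> f * g != 0 -> D (f * g) = 0 -> D f = 0.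
Proof.
move=> domA fg0 Dfg.
have exp_neq0 h : h != 0 -> exp_poly h != 0.
  move=> h0; apply: contraNneq h0 => Eh.
  by rewrite -(exp_poly_coef0 h) Eh coef0.
have f0 : f != 0 by apply: contraNneq fg0 => ->; rewrite mul0r.
have g0 : g != 0 by apply: contraNneq fg0 => ->; rewrite mulr0.
have lead_neq0 : lead_coef (exp_poly f) * lead_coef (exp_poly g) != 0.
  apply/eqP => lead0; have := domA _ _ lead0; rewrite !lead_coef_eq0.
  by rewrite (negPf (exp_neq0 _ f0)) (negPf (exp_neq0 _ g0)).
have := size_proper_mul lead_neq0; rewrite -exp_polyM exp_poly_const //.
rewrite size_polyC fg0 => sz.
have szf : (size (exp_poly f) <= 1)%N.
  move: sz (exp_neq0 _ f0) (exp_neq0 _ g0); rewrite -!size_poly_gt0.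
  case: (size (exp_poly f)) (size (exp_poly g)) => [|[|a]] // [|b] //.
  by rewrite addnS !addSn.
have := coef_exp_poly f 1; rewrite /divided_power invr1 scale1r /= => <-.
by rewrite nth_default.
Qed.

Definition exp_conj t (E : {linear A -> A}) : {linear A -> A} :=
  exp_at (- t) \o E \o exp_at t.

(** Both local nilpotency and a slice [s] are transported by the automorphism:
    the new slice is exp(-tD) s. *)
Lemma LND_star_exp_conj t E : LND_star A E -> LND_star A (exp_conj t E).
Proof.
move=> [[derE nilE] [s Es]]; split; first split.
- move=> f g; rewrite /= exp_atM derE linearD /= !exp_atM.
  by rewrite !exp_atK.
- move=> f; have [m m_gt0 Em] := nilE (exp_at t f); exists m => //.
  have ->: iter m (exp_conj t E) f = exp_at (- t) (iter m E (exp_at t f)).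
    elim: m {m_gt0 Em} => [|m IHm] /=; first by rewrite exp_atK.
    by rewrite IHm /= exp_atNK.
  by rewrite Em linear0.
- by exists (exp_at (- t) s); rewrite /is_slice /= exp_atNK Es exp_at1.
Qed.

(** [E] kills exp(tD) f for every t, because its conjugate by exp(tD) kills [f];
    then all the coefficients of this polynomial in t are killed, in particular
    [D f]. *)
Lemma ML_star_stable f : ML_star A f -> ML_star A (D f).
Proof.
move=> Mf E starE.
have vanish t : (map_poly E (exp_poly f)).[t%:A] = 0.
  have /(congr1 (exp_at t)) := Mf _ (LND_star_exp_conj t starE).
  by rewrite /= exp_atNK linear0 -horner_map_scalar.
have E0 : map_poly E (exp_poly f) = 0.
  apply: (@eq0_of_scalar_roots K A
    [seq i%:R | i <- iota 0 (size (map_poly E (exp_poly f)))]).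
  - by rewrite (map_inj_uniq natK_inj) iota_uniq.
  - by move=> r _; exact: vanish.
  - by rewrite size_map size_iota.
have := congr1 (fun p : {poly A} => p`_1) E0.
by rewrite coef0 coef_map coef_exp_poly /divided_power invr1 scale1r.
Qed.
End OneDerivation.
End Exponential.

(** * Multiplying and iterating derivations *)

Lemma LND_mul_kernel (K : fieldType) (A : comAlgType K) (D : {linear A -> A})
    (u : A) :
  LND A D -> D u = 0 -> LND A (u \*o D).
Proof.
move=> [derD nilD] Du; split=> [f g|f] /=.
  by rewrite derD mulrDr !(mulrCA u).
have [m m_gt0 Dm] := nilD f; exists m => //.
have -> : iter m (u \*o D) f = u ^+ m * iter m D f.
  have Dun i : D (u ^+ i) = 0.
    elim: i => [|i IHi]; first by rewrite derivation1.
    by rewrite exprS derD IHi Du !mulr0 addr0.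
  elim: m {m_gt0 Dm} => [|m IHm] /=; first by rewrite mul1r.
  by rewrite IHm derD Dun mulr0 addr0 mulrA -exprS.
by rewrite Dm mulr0.
Qed.

Lemma iter_derivation_affineM (K : fieldType) (A : comAlgType K)
    (D : {linear A -> A}) (f h : A) n :
  is_derivation D -> D (D f) = 0 ->
  iter n.+1 D (f * h) = f * iter n.+1 D h + (D f * iter n D h) *+ n.+1.
Proof.
move=> derD D2f; elim: n => [|n IHn]; first by rewrite /= derD [_ * D f]mulrC.
rewrite iterS IHn linearD linearMn /= !derD D2f mulr0 addr0.
by rewrite [X in _ + X + _]mulrC -addrA -mulrS.
Qed.

(** * The two invariants of a domain *)

Section Invariants.
Variables (K : fieldType) (A : comAlgType K).
Hypotheses (char0 : [pchar K] =i pred0).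
Hypothesis domA : GRing.integral_domain_axiom A.

Lemma ML_star_factorially_closed (f g : A) :
  f * g != 0 -> ML_star A (f * g) -> ML_star A f.
Proof.
move=> fg0 Mfg D /[dup] starD [[derD nilD] _].
exact: (kernel_factorially_closed char0 nilD derD domA fg0 (Mfg D starD)).
Qed.

Lemma ML_starB (f g : A) : ML_star A f -> ML_star A g -> ML_star A (f - g).
Proof.
by move=> Mf Mg D starD; rewrite /Ker /= linearB (Mf D starD) (Mg D starD) subrr.
Qed.

Lemma ML_starM (f g : A) : ML_star A f -> ML_star A g -> ML_star A (f * g).
Proof.
move=> Mf Mg D /[dup] starD [[derD _] _].
by rewrite /Ker /= derD (Mf D starD) (Mg D starD) !mulr0 addr0.
Qed.

Section LocalSliceInMLStar.
Variables (D : {linear A -> A}) (f : A).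
Hypotheses (lndD : LND A D) (Mf : ML_star A f).
Hypotheses (Df_neq0 : D f != 0) (D2f : D (D f) = 0).

(** [u \*o D] is locally nilpotent, so it preserves [ML_star A] and puts the
    nonzero multiple [u * D f] of [u] there. *)
Lemma ML_star_kernel u : D u = 0 -> ML_star A u.
Proof.
move=> Du; have [u0|u_neq0] := eqVneq u 0.
  by move=> E _; rewrite u0; exact: linear0.
apply: (@ML_star_factorially_closed u (D f)).
  apply/eqP => uDf0; have := domA uDf0.
  by rewrite (negPf u_neq0) (negPf Df_neq0).
have [derU nilU] := LND_mul_kernel lndD Du.
exact: (ML_star_stable char0 nilU derU Mf).
Qed.

(** Induction on the nilpotency order of [a].  If [D] kills [a] after n + 2
    steps, the top terms of (n + 1) (D f) a and f (D a) agree, so their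
    difference is killed after n + 1 steps; as [f] and [D a] belong to
    [ML_star A], so does the multiple (n + 1) (D f) a of [a]. *)
Lemma ML_star_full a : ML_star A a.
Proof.
have [derD nilD] := lndD.
have [n _] := nilD a; elim: n a => [|n IHn] a.
  by move=> /= -> E _; exact: linear0.
case: n IHn => [|n] IHn Dna; first exact: ML_star_kernel.
have MDa : ML_star A (D a) by apply: IHn; rewrite -iterSr.
have Mga : ML_star A ((D f * a) *+ n.+1).
  rewrite -[_ *+ _](subKr (f * D a)); apply: ML_starB.
    exact: ML_starM.
  apply: IHn; rewrite linearB linearMn /= -!iterS.
  rewrite !iter_derivation_affineM // D2f ?linear0 //.
  by rewrite -!iterSr Dna mulr0 add0r mul0r mul0rn addr0 subrr.
have [a0|a_neq0] := eqVneq a 0.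
  by move=> E _; rewrite a0; exact: linear0.
apply: (@ML_star_factorially_closed a (D f *+ n.+1)); last first.
  by rewrite mulrnAr mulrC.
apply/eqP => aDf0; have := domA aDf0; rewrite (negPf a_neq0) => /eqP /(mulrSn_eq0 char0).
exact/eqP.
Qed.
End LocalSliceInMLStar.

(** A locally nilpotent derivation not vanishing on [ML_star A] has a local
    slice there, which forces [ML_star A] to contain every slice. *)
Theorem ML_eq_ML_star : LND_star A !=set0 -> ML A = ML_star A.
Proof.
move=> [E starE]; apply/seteqP; split=> [f Mf D [lndD _]|f Mf D lndD].
  exact: Mf.
rewrite /Ker /=; apply: contrapT => Df_neq0.
have [derD nilD] := lndD.
have exn : exists n, iter n D f == 0.
  by have [m _ /eqP Dm] := nilD f; exists m.
have Miter i : ML_star A (iter i D f).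
  by elim: i => //= i; exact: ML_star_stable.
(* With [n.+2] the least order killing [f], the element [iter n D f] is a local
   slice; orders 0 and 1 would make [D f] vanish. *)
case: (ex_minnP exn) => -[|[|n]] /eqP Dn minn.
- by apply: Df_neq0; rewrite -[f]/(iter 0 D f) Dn linear0.
- exact: Df_neq0.
have Dn1 : D (iter n D f) != 0.
  by apply/negP => /(minn n.+1); rewrite ltnn.
have [_ [s Es]] := starE.
have /= := ML_star_full lndD (Miter n) Dn1 Dn s starE.
by rewrite /Ker /= Es => /eqP; rewrite oner_eq0.
Qed.
End Invariants.

(** * Coordinate rings of irreducible varieties *)

Lemma algebraic_set_hypersurface (K : closedFieldType) (n : nat)
    (X : irr_affine_variety K n) (p : {mpoly K[n]}) :
  algebraic_set [set x | points X x /\ p.@[x] = 0].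
Proof.
have [S XE] := points_algebraic X; exists (S `|` [set p]).
rewrite XE; apply/seteqP; split=> [x [Sx px] q [/Sx //|-> //]|x Sx].
by split=> [q Sq|]; apply: Sx; [left|right].
Qed.

(** If [f * g = 0], the variety is the union of the zero sets of [f] and [g], so
    by irreducibility one of them is everything. *)
Lemma coord_ring_domain (K : closedFieldType) (n : nat)
    (X : irr_affine_variety K n) :
  GRing.integral_domain_axiom (coord_ring X).
Proof.
move=> f g fg0; have [_ irrX] := points_irreducible X.
have /asboolP[p fE] := coord_funP f; have /asboolP[q gE] := coord_funP g.
have eq0P (h : coord_ring X) r : coord_fun h = (fun x => r.@[val x]) ->
    [set x | points X x /\ r.@[x] = 0] = points X -> h = 0.
  move=> hE Xr; apply/val_inj/funext => x /=; rewrite hE.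
  by have := set_valP x; rewrite -{1}Xr => -[].
case: (irrX _ _ (algebraic_set_hypersurface X p) (algebraic_set_hypersurface X q)).
- apply/seteqP; split=> [x Xx|x [] []//].
  have /(congr1 (fun h : coord_ring X => h (SigSub (mem_set Xx)))) := fg0.
  move=> /= /eqP; rewrite fE gE mulf_eq0 /= => /orP[] /eqP; [left|right] => //.
- by move/(eq0P f p fE) => ->; rewrite eqxx.
- by move/(eq0P g q gE) => ->; rewrite eqxx orbT.
Qed.

Theorem theorem1 (K : closedFieldType) (char0 : [pchar K] =i pred0)
    (n : nat) (X : irr_affine_variety K n) :
  LND_star (coord_ring X) !=set0 ->
  ML (coord_ring X) = ML_star (coord_ring X).
Proof. exact: (ML_eq_ML_star char0 (@coord_ring_domain K n X)). Qed.
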